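(* Let $P$ be a finite ranked poset of rank $2$. Then \[ \sum_{v \in P_0} R_0(v) - \sum_{e \in P_1} R_1(e) + \sum_{\sigma \in P_2} R_2(\sigma) = \chi_{gr}(P). \]
   Context: For a poset $P$, write $a \prec b$ if $b$ covers $a$. A rank function for $P$ is a function $\rho: P \to \{0,1,\dots,r\}$ (some $r \in \mathbb{N}\cup\{0\}$) such that $\rho(a)=0$ for every minimal element $a$, and $\rho(b)=\rho(a)+1$ whenever $a \prec b$. $P$ is ranked if it has a rank function (which is then unique); its rank is the smallest possible such $r$. For $i \in \{0,\dots,r\}$ let $P_i=\{x\in P \mid \rho(x)=i\}$ and $p_i=|P_i|$. The ranked Euler characteristic of a finite ranked poset of rank $r$ is $\chi_{gr}(P)=\sum_{i=0}^r(-1)^i p_i$. For $x\in P_i$ define $A_i(x)=|\{y\in P_{i+1}\mid x\prec y\}|$, $B_i(x)=|\{z\in P_{i-1}\mid z\prec x\}|$, $U_i(x)=\sum_{y\succ x}B_{i+1}(y)$, $D_i(x)=\sum_{z\prec x}A_{i-1}(z)$ (empty sums are $0$). For a ranked poset of rank $2$ define, for $v\in P_0$, $e\in P_1$, $\sigma\in P_2$: $R_0(v)=1+\tfrac32A_0(v)-A_0(v)^2$, $R_1(e)=1+6A_1(e)+\tfrac32B_1(e)-U_1(e)-D_1(e)$, $R_2(\sigma)=1+6B_2(\sigma)-B_2(\sigma)^2$. *)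

(* Defs.v *)
From HB Require Import structures.
From mathcomp Require Import all_boot all_order all_algebra.
Set Implicit Arguments.
Unset Strict Implicit.
Unset Printing Implicit Defensive.
Import Order.TTheory GRing.Theory Num.Theory.

Section Poset.
Context {d : Order.disp_t} {P : finPOrderType d}.
Implicit Types (x y z : P) (rho : P -> nat).

Definition covered x y : bool :=
  (x < y)%O && [forall z : P, ~~ ((x < z)%O && (z < y)%O)].

Definition minimal_elt x : bool := [forall z : P, ~~ (z < x)%O].

(* The codomain {0, ..., r} is encoded as nat together with a bound. *)
Definition rank_function (r : nat) rho : Prop :=
  [/\ forall x, rho x <= r,
      forall x, minimal_elt x -> rho x = 0
    & forall x y, covered x y -> rho y = (rho x).+1].

(* Uniqueness of rank functions; this is why the notions below may take an
   arbitrary rank function rho as a parameter. *)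
Lemma rank_function_unique r s rho rho' :
  rank_function r rho -> rank_function s rho' -> rho =1 rho'.
Proof.
move=> [_ min1 cov1] [_ min2 cov2] x.
have [n] := ubnP #|[set z | (z < x)%O]|; elim: n x => // n IHn x le_x_n.
have [min_x|] := boolP (minimal_elt x); first by rewrite min1 ?min2.
rewrite negb_forall => /existsP[z0]; rewrite negbK => lt_z0x.
case: (@arg_maxnP _ z0 (fun z => z < x)%O (fun z => #|[set w | (w < z)%O]|))
  => // z lt_zx zmax.
have sub_lt (a b : P) : (a < b)%O ->
    #|[set w | (w < a)%O]| < #|[set w | (w < b)%O]|.
  move=> lt_ab; apply/proper_card/properP; split.
    by apply/subsetP=> w; rewrite !inE => /lt_trans; apply.
  by exists a; rewrite !inE ?ltxx.
have cov_zx : covered z x.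
  rewrite /covered lt_zx; apply/forallP=> w; apply/negP=> /andP[lt_zw lt_wx].
  by have := zmax w lt_wx; rewrite /= leqNgt sub_lt.
rewrite (cov1 _ _ cov_zx) (cov2 _ _ cov_zx) IHn //.
exact: leq_trans (sub_lt _ _ lt_zx) _.
Qed.

Section RankFunction.
Variable rho : P -> nat.

Definition level (i : nat) : {set P} := [set x | rho x == i].

Definition degA (i : nat) x : nat := #|[set y in level i.+1 | covered x y]|.

(* "rho z + 1 = i" expresses z \in P_{i-1}, with P_{-1} empty. *)
Definition degB (i : nat) x : nat :=
  #|[set z : P | ((rho z).+1 == i) && covered z x]|.

Definition sumU (i : nat) x : nat := \sum_(y | covered x y) degB i.+1 y.

(* For i = 0 the truncated index i.-1 is harmless: elements of rank 0 cover
   nothing, so the sum is empty. *)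
Definition sumD (i : nat) x : nat := \sum_(z | covered z x) degA i.-1 z.

Local Open Scope ring_scope.

Definition chi_gr (r : nat) : rat :=
  \sum_(i < r.+1) (-1) ^+ i * #|level i|%:R.

Definition R0 x : rat :=
  1 + 3%:R / 2%:R * (degA 0 x)%:R - (degA 0 x)%:R ^+ 2.

Definition R1 x : rat :=
  1 + 6%:R * (degA 1 x)%:R + 3%:R / 2%:R * (degB 1 x)%:R
    - (sumU 1 x)%:R - (sumD 1 x)%:R.

Definition R2 x : rat :=
  1 + 6%:R * (degB 2 x)%:R - (degB 2 x)%:R ^+ 2.

End RankFunction.
End Poset.

Definition has_rank {d : Order.disp_t} (P : finPOrderType d) (r : nat) : Prop :=
  (exists rho : P -> nat, rank_function r rho) /\
  (forall (s : nat) (rho : P -> nat), rank_function s rho -> r <= s).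

(* Main.v *)
Require Import Defs.
From mathcomp Require Import all_boot all_order all_algebra.
From mathcomp Require Import ring.
Import GRing.Theory.
Local Open Scope ring_scope.

(** Counting the covering pairs between two consecutive levels from either end
    gives [sum A_0 = sum B_1] and [sum A_1 = sum B_2]; weighting each pair by
    [B_2] of its top, respectively by [A_0] of its bottom, gives
    [sum U_1 = sum B_2^2] and [sum D_1 = sum A_0^2].  All non-constant terms of
    the curvatures then cancel, and the constants [1] add up to [chi_gr]. *)

Section DoubleCounting.
Context {d : Order.disp_t} {P : finPOrderType d}.
Variables (rho : P -> nat) (r : nat).
Hypothesis rho_rank : rank_function r rho.
Implicit Types (x y z : P) (i : nat) (F : P -> nat).

(** A cover raises the rank by exactly one, so level membership can be transferred across a covering
    pair in either direction. *)
Lemma level_covered i x y :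
  covered x y -> (x \in level rho i) = (y \in level rho i.+1).
Proof. by case: rho_rank => _ _ cov /cov rho_y; rewrite !inE rho_y. Qed.

Lemma degA_covered i x :
  x \in level rho i -> degA rho i x = #|[set y | covered x y]|.
Proof.
move=> x_i; apply: eq_card => y; rewrite !(inE, in_set).
by case: (boolP (covered x y)) => [/(level_covered i)|_];
  rewrite ?andbF // x_i inE => <-.
Qed.

Lemma degB_covered i y :
  y \in level rho i.+1 -> degB rho i.+1 y = #|[set z | covered z y]|.
Proof.
move=> y_i; apply: eq_card => z; rewrite !(inE, in_set) eqSS.
by case: (boolP (covered z y)) => [/(level_covered i)|_];
  rewrite ?andbF // y_i inE => ->.
Qed.

(** Both sides run over the covering pairs between two consecutive levels. *)
Lemma exchange_covered i (F : P -> P -> nat) :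
  (\sum_(x in level rho i) \sum_(y | covered x y) F x y =
   \sum_(y in level rho i.+1) \sum_(x | covered x y) F x y)%N.
Proof.
rewrite (exchange_big_dep (mem (level rho i.+1))) /=; last first.
  by move=> x y x_i /(level_covered i) <-.
apply: eq_bigr => y y_i; apply: eq_bigl => x.
by case: (boolP (covered x y)) => [/(level_covered i)->|_];
  rewrite ?andbF // y_i.
Qed.

Lemma sum_covered_up i F :
  (\sum_(x in level rho i) \sum_(y | covered x y) F y =
   \sum_(y in level rho i.+1) degB rho i.+1 y * F y)%N.
Proof.
rewrite exchange_covered; apply: eq_bigr => y y_i.
(* The weight [F y] is constant in the inner sum over the elements that [y] covers. *)
by rewrite sum_nat_const degB_covered // cardsE.
Qed.

Lemma sum_covered_down i F :
  (\sum_(y in level rho i.+1) \sum_(x | covered x y) F x =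
   \sum_(x in level rho i) degA rho i x * F x)%N.
Proof.
rewrite -exchange_covered; apply: eq_bigr => x x_i.
by rewrite sum_nat_const degA_covered // cardsE.
Qed.

Lemma sum_degA_degB i :
  (\sum_(x in level rho i) degA rho i x =
   \sum_(y in level rho i.+1) degB rho i.+1 y)%N.
Proof.
transitivity (\sum_(y in level rho i.+1) degB rho i.+1 y * 1)%N.
  rewrite -sum_covered_up; apply: eq_bigr => x x_i.
  by rewrite sum1_card degA_covered // cardsE.
by apply: eq_bigr => y _; rewrite muln1.
Qed.

Lemma sum_sumU i :
  (\sum_(x in level rho i) sumU rho i x =
   \sum_(y in level rho i.+1) degB rho i.+1 y ^ 2)%N.
Proof. by rewrite sum_covered_up; apply: eq_bigr => y _; rewrite mulnn. Qed.

(** At index [i.+1] the predecessor inside [sumD] computes to [i], so the weight is [degA rho i]. *)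
Lemma sum_sumD i :
  (\sum_(y in level rho i.+1) sumD rho i.+1 y =
   \sum_(x in level rho i) degA rho i x ^ 2)%N.
Proof. by rewrite sum_covered_down; apply: eq_bigr => x _; rewrite mulnn. Qed.

(** Each sum is kept as the cast of a sum in [nat], the form in which the counting identities can
    rewrite it. *)
Lemma sum_R0 :
  \sum_(v in level rho 0) R0 rho v =
  #|level rho 0|%:R + 3%:R / 2%:R * (\sum_(v in level rho 0) degA rho 0 v)%:R
    - (\sum_(v in level rho 0) degA rho 0 v ^ 2)%:R.
Proof.
rewrite sumrB big_split /= sumr_const -mulr_sumr !natr_sum.
by under [X in _ - X = _]eq_bigr do rewrite -natrX.
Qed.

Lemma sum_R1 :
  \sum_(e in level rho 1) R1 rho e =
  #|level rho 1|%:R + 6%:R * (\sum_(e in level rho 1) degA rho 1 e)%:R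
    + 3%:R / 2%:R * (\sum_(e in level rho 1) degB rho 1 e)%:R
    - (\sum_(e in level rho 1) sumU rho 1 e)%:R
    - (\sum_(e in level rho 1) sumD rho 1 e)%:R.
Proof.
by rewrite !sumrB !big_split /= sumr_const -!mulr_sumr !natr_sum.
Qed.

Lemma sum_R2 :
  \sum_(s in level rho 2) R2 rho s =
  #|level rho 2|%:R + 6%:R * (\sum_(s in level rho 2) degB rho 2 s)%:R
    - (\sum_(s in level rho 2) degB rho 2 s ^ 2)%:R.
Proof.
rewrite sumrB big_split /= sumr_const -mulr_sumr !natr_sum.
by under [X in _ - X = _]eq_bigr do rewrite -natrX.
Qed.

End DoubleCounting.

Theorem theorem2p4 (d : Order.disp_t) (P : finPOrderType d) (rho : P -> nat)
    (hrank : has_rank P 2) (hrho : rank_function 2 rho) :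
  \sum_(v in level rho 0) R0 rho v
    - \sum_(e in level rho 1) R1 rho e
    + \sum_(s in level rho 2) R2 rho s
  = chi_gr rho 2.
Proof.
rewrite sum_R0 sum_R1 sum_R2 (sum_sumU _ _ hrho) (sum_sumD _ _ hrho).
(* Used at both [i = 0] and [i = 1]; only the sums of [degB], the sums of squares and the level
   sizes remain as atoms for [ring]. *)
rewrite !(sum_degA_degB _ _ hrho) /chi_gr !big_ord_recr big_ord0 /=.
by ring.
Qed.
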